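(* Let $m$ be the Lebesgue measure, let $\gamma:[0,1]\to\mathbb{R}$ be nondecreasing, concave and continuous on $[0,1]$ with $\gamma(0)=0$, and let $\mu$ be the distorted Lebesgue measure $\mu(A)=\gamma(m(A))$. Let $1<p<+\infty$. Then the Volterra-Choquet operator $V(f)(x)=(C)\int_{[0,x]}f(t)\,d\mu(t)$, $x\in[0,1]$, regarded as a map $$V:L_{p,\mu}^{+}([0,1])\to C_{+}[0,1]\subset C[0,1],$$ is a nonlinear compact operator. Here $L_{p,\mu}^{+}([0,1])$ is endowed with the metric generated by the norm $\|\cdot\|_{L_{p,\mu}([0,1])}$, and $C_{+}[0,1]$ is the space of all nonnegative real-valued continuous functions on $[0,1]$, endowed with the metric generated by the uniform norm.
   Context: Let $\mathcal{C}$ be the $\sigma$-algebra of Borel subsets (or alternatively of Lebesgue measurable subsets) of $[0,1]$. A set function $\mu:\mathcal{C}\to[0,+\infty]$ is monotone if $\mu(\emptyset)=0$ and $\mu(A)\le\mu(B)$ whenever $A,B\in\mathcal{C}$, $A\subset B$. Choquet integral: for $\mu$ monotone, $f:[0,1]\to\mathbb{R}$ $\mathcal{C}$-measurable and $A\in\mathcal{C}$, $$(C)\int_{A}f\,d\mu=\int_{0}^{+\infty}\mu(\{\omega\in A: f(\omega)\ge\beta\})\,d\beta+\int_{-\infty}^{0}\left[\mu(\{\omega\in A: f(\omega)\ge\beta\})-\mu(A)\right]d\beta .$$ Spaces: $\|f\|_{L_{p,\mu}([0,1])}=\left((C)\int_{0}^{1}|f(t)|^{p}\,d\mu(t)\right)^{1/p}$,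 where $(C)\int_0^1$ means $(C)\int_{[0,1]}$; $L_{p,\mu}^{+}([0,1])$ is the set of $\mathcal{C}$-measurable functions $f:[0,1]\to[0,+\infty)$ with $(C)\int_{0}^{1}|f(t)|^{p}d\mu(t)<+\infty$. The metric is $d(f,g)=\|f-g\|_{L_{p,\mu}([0,1])}$; as usual, functions whose difference $h$ satisfies $\|h\|_{L_{p,\mu}([0,1])}=0$ are identified. Compactness: a (not necessarily linear) operator $A:X\to Y$ between metric spaces is compact if it is continuous on $X$ and, for every bounded $M\subset X$ (i.e. $\sup\{\rho(x,y):x,y\in M\}<+\infty$, where $\rho$ is the metric of $X$), the set $A(M)$ is relatively compact in $Y$ (its closure is compact in $Y$). *)

(* Defs.v *)
From HB Require Import structures.
From mathcomp Require Import all_boot all_order all_algebra.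
From mathcomp Require Import all_classical all_reals all_analysis.

Set Implicit Arguments.
Unset Strict Implicit.
Unset Printing Implicit Defensive.

Import Order.TTheory GRing.Theory Num.Theory.
Import numFieldNormedType.Exports.

Local Open Scope classical_set_scope.
Local Open Scope ring_scope.

Definition borel_sets (R : realType) : set (set R) :=
  @measurable _ (measurableTypeR R).

(* Caratheodory's sigma-algebra of the Lebesgue outer measure.  As a set
   function, [lebesgue_measure] is this outer measure (defined on all sets), so
   it gives the Lebesgue measure both on Borel and on Lebesgue measurable
   sets. *)
Definition lebesgue_sets (R : realType) : set (set R) :=
  (@wlength R idfun)^*%mu.-cara.-measurable.

(* Functions on [0, 1] are represented by functions on R of which only the
   values on [0, 1] are used; the sets of the sigma-algebra C on [0, 1] are the
   members of C included in [0, 1]. *)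
Definition measurable_on01 (R : realType) (C : set (set R)) (f : R -> R) :=
  forall B : set R, borel_sets B -> C (`[0, 1] `&` f @^-1` B).

Definition choquet (R : realType) (mu : set R -> \bar R) (A : set R)
    (f : R -> R) : \bar R :=
  (\int[lebesgue_measure]_(b in `[0%R, +oo[)
      mu (A `&` [set w | (b <= f w)%R])
   + \int[lebesgue_measure]_(b in `]-oo, 0%R])
      (mu (A `&` [set w | (b <= f w)%R]) - mu A))%E.

Definition distorted_lebesgue (R : realType) (gamma : R -> R) (A : set R) :
    \bar R :=
  (gamma (fine (lebesgue_measure A)))%:E.

Definition concave_on (R : realType) (D : set R) (g : R -> R) :=
  forall x y t : R, D x -> D y -> 0 <= t <= 1 ->
    t * g x + (1 - t) * g y <= g (t * x + (1 - t) * y).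

Section choquet_Lp.
Context {R : realType} (C : set (set R)) (mu : set R -> \bar R) (p : R).

Definition choquet_Lp_norm (f : R -> R) : \bar R :=
  (choquet mu `[0%R, 1%R] (fun t => (`|f t| `^ p)%R) `^ p^-1)%E.

Record Lp_plus := LpPlus {
  Lp_fun :> R -> R ;
  Lp_measurable : measurable_on01 C Lp_fun ;
  Lp_ge0 : forall t, t \in `[0, 1] -> 0 <= Lp_fun t ;
  Lp_finite : (choquet mu `[0%R, 1%R] (fun t => (`|Lp_fun t| `^ p)%R) < +oo)%E }.

Definition Lp_dist (f g : Lp_plus) : \bar R := choquet_Lp_norm (f \- g).

End choquet_Lp.

Definition volterra_choquet (R : realType) (mu : set R -> \bar R) (f : R -> R)
    (x : R) : \bar R :=
  choquet mu `[0, x] f.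

Notation unit_interval R := (set_type (`[0%R, 1%R] : set R)).

Record C_plus (R : realType) := CPlus {
  C_fun :> continuousType (unit_interval R) R ;
  C_ge0 : forall x, 0 <= C_fun x }.

Definition uniform_dist (R : realType) (f g : unit_interval R -> R) : R :=
  sup (range (fun x => `|f x - g x|)).

Section C_plus_metric.
Context {R : realType}.
Implicit Types f g h : C_plus R.

Lemma C_plus_ext f g : f =1 g -> f = g.
Proof.
case: f g => [f f0] [g g0] /= /continuousEP fg.
by subst g; congr CPlus; exact: Prop_irrelevance.
Qed.

Lemma uniform_dist_has_sup f g : has_sup (range (fun x => `|f x - g x|)).
Proof.
have I0 : (0 : R) \in `[0%R, 1%R]%classic by rewrite inE/= in_itv/= lexx ler01.
pose x0 : unit_interval R := SigSub I0.
split; first by exists `|f x0 - g x0|, x0.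
pose k : unit_interval R -> R := fun x => `|f x - g x|.
have ck : continuous k.
  move=> x; apply: (@continuous_comp _ _ _ (fun x => f x - g x) Num.norm).
    by apply: continuousB; exact: cts_fun.
  exact: norm_continuous.
have /subspace_valL_continuousP ck' := ck.
have [c _ cmax] := EVT_max ler01 ck'.
exists (valL k c) => _ [x _ <-].
have xI : set_val x \in `[0, 1] by have := set_valP x.
have := cmax _ xI; have /(congr1 (@^~ x)) := valLK point k.
by rewrite /sigL /= => ->.
Qed.

Lemma le_uniform_dist f g x : `|f x - g x| <= uniform_dist f g.
Proof. by apply: sup_upper_bound; [exact: uniform_dist_has_sup|exists x]. Qed.

Lemma uniform_dist_le f g (c : R) :
  (forall x, `|f x - g x| <= c) -> uniform_dist f g <= c.
Proof.
move=> fgc; apply: ge_sup; first exact: (uniform_dist_has_sup f g).1.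
by move=> _ [x _ <-].
Qed.

Lemma uniform_dist_sym f g : uniform_dist f g = uniform_dist g f.
Proof. by congr (sup (_ @` _)); apply/funext => x; rewrite distrC. Qed.

Lemma uniform_distxx f : uniform_dist f f = 0.
Proof.
apply/eqP; rewrite eq_le; apply/andP; split.
  by apply: uniform_dist_le => x; rewrite subrr normr0.
have [[_ [x _ _]] _] := uniform_dist_has_sup f f.
exact: le_trans (le_uniform_dist f f x).
Qed.

Lemma uniform_dist_positivity f g : uniform_dist f g = 0 -> f = g.
Proof.
move=> fg0; apply: C_plus_ext => x; apply/eqP; rewrite -subr_eq0 -normr_le0.
by have := le_uniform_dist f g x; rewrite fg0.
Qed.

Lemma uniform_dist_triangle g f h :
  uniform_dist f h <= uniform_dist f g + uniform_dist g h.
Proof.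
apply: uniform_dist_le => x; rewrite (le_trans (ler_distD (g x) _ _))//.
by rewrite lerD// le_uniform_dist.
Qed.

HB.instance Definition _ := gen_eqMixin (C_plus R).
HB.instance Definition _ := gen_choiceMixin (C_plus R).
HB.instance Definition _ := @isMetric.Build R (C_plus R)
  (fun f g => uniform_dist f g) uniform_distxx uniform_dist_positivity
  uniform_dist_sym uniform_dist_triangle.

End C_plus_metric.

(* [rho] is a distance on X before identification of the points at distance 0.
   It is allowed to be extended-real valued so that no finiteness has to be
   presupposed.  The identification is expressed by requiring A to be
   well-defined on classes; continuity, boundedness and the image of a set are
   insensitive to the choice of representatives. *)
Section compact_operator.
Context {R : realType} {X : Type} (rho : X -> X -> \bar R) {Y : metricType R}.

Definition rho_bounded (M : set X) :=
  (ereal_sup [set rho z.1 z.2 | z in M `*` M] < +oo)%E.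

Definition rho_continuous (A : X -> Y) :=
  forall x (e : R), 0 < e -> exists2 d : R, 0 < d &
    forall y, (rho x y < d%:E)%E -> mdist (A x) (A y) < e.

Definition compact_operator (A : X -> Y) :=
  [/\ forall x y, rho x y = 0%E -> A x = A y,
      rho_continuous A &
      forall M : set X, rho_bounded M -> compact (closure (A @` M))].

End compact_operator.

(* Main.v *)
Require Import Defs.
From HB Require Import structures.
From mathcomp Require Import all_boot all_order all_algebra.
From mathcomp Require Import all_classical all_reals all_analysis.
From mathcomp Require Import measurable_realfun.
From mathcomp Require Import ring lra.

Set Implicit Arguments.
Unset Strict Implicit.
Unset Printing Implicit Defensive.

Import Order.TTheory GRing.Theory Num.Theory.
Import numFieldNormedType.Exports.

Local Open Scope classical_set_scope.
Local Open Scope ring_scope.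

(* A pointwise bound f <= max (c g) (d h) turns, by monotonicity and
   subadditivity of mu and by the scaling of the Lebesgue measure in the level
   variable, into the same bound (C)int f <= c (C)int g + d (C)int h on Choquet
   integrals of nonnegative functions.  Three instances of it suffice:
   - f <= max K (K^(1-p) f^p), in place of Hoelder's inequality, bounds
     V(f)(y) - V(f)(x) by K gamma(y - x) + K^(1-p) (C)int f^p;
   - f <= max ((1+eta) g) ((1+1/eta) |f-g|), in place of the subadditivity of
     the Choquet integral, gives the continuity of V;
   - |f|^p <= max (2^p |g|^p) (2^p |f-g|^p) bounds (C)int f^p on bounded sets.
   Hence the image of a bounded set is bounded and equicontinuous, and one
   concludes by the Arzela-Ascoli theorem. *)

(** * Scaling of the level variable in Lebesgue integrals *)

Lemma lebesgue_measure_scale (R : realType) (c : R) (A : set R) : 0 < c ->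
  measurable A ->
  pushforward lebesgue_measure
    (fun b : measurableTypeR R => b / c : measurableTypeR R) A =
    (c%:E * lebesgue_measure A)%E.
Proof.
move=> c0 mA.
have mdiv : measurable_fun setT
    (fun b : measurableTypeR R => b / c : measurableTypeR R).
  exact: measurable_funM.
have [m mE] : exists m : measure (measurableTypeR R) R, forall B : set R,
    m B = lebesgue_measure ((fun b : R => b / c) @^-1` B).
  unshelve eexists (pushforward lebesgue_measure
    (fun b : measurableTypeR R => b / c : measurableTypeR R) :
    measure _ _) => //.
have ci0 : 0 <= c^-1 by rewrite invr_ge0 ltW.
(* The Lebesgue measure is determined by its values on the intervals []a, b]], whose preimage under
   division by [c] is []a * c, b * c]]. *)
have -> : lebesgue_measure A = mscale (NngNum ci0) m A.
  apply: lebesgue_measure_unique => // _ [[a b] _ <-].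
  rewrite /= /mscale/= mE.
  have -> : (fun t : R => t / c) @^-1` `]a, b]%classic = `]a * c, b * c]%classic.
    by apply/seteqP; split=> x/=; rewrite !in_itv/= ltr_pdivlMr// ler_pdivrMr.
  rewrite !lebesgue_measure_itv/= !lte_fin ltr_pM2r//; case: ifP => _.
    by rewrite -!EFinB -EFinM -mulrBl mulrCA mulVf ?mulr1// gt_eqF.
  by rewrite mule0.
by rewrite /= /mscale/= mE muleA -EFinM divff ?gt_eqF// mul1e.
Qed.

(** Both sides are the integral of [phi] against the pushforward of the Lebesgue measure under
    [b / c]; the half-line [[0, +oo[] is its own preimage under this map. *)
Lemma ge0_integral_scale (R : realType) (c : R) (phi : R -> \bar R) : 0 < c ->
  measurable_fun setT phi -> (forall b, 0 <= phi b)%E ->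
  (\int[lebesgue_measure]_(b in `[0%R, +oo[) phi (b / c)%R =
   c%:E * \int[lebesgue_measure]_(b in `[0%R, +oo[) phi b)%E.
Proof.
move=> c0 mphi phi0.
have mdiv : measurable_fun setT
    (fun b : measurableTypeR R => b / c : measurableTypeR R).
  exact: measurable_funM.
pose D : set (measurableTypeR R) := `[0, +oo[%classic.
have mD : measurable D by exact: measurable_itv.
have mphiD : measurable_fun D phi by exact: measurable_funS mphi.
rewrite -/D -(@ge0_integral_mscale _ _ _ lebesgue_measure D mD
  (NngNum (ltW c0)) phi)//.
rewrite [RHS](eq_measure_integral (pushforward lebesgue_measure
  (fun b : measurableTypeR R => b / c : measurableTypeR R)))//=; last first.
  by move=> A mA _; rewrite /mscale/= lebesgue_measure_scale.
rewrite ge0_integral_pushforward//=.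
suff -> :
  (fun b : measurableTypeR R => b / c : measurableTypeR R) @^-1` D = D by [].
by apply/seteqP; split=> x; rewrite /D /preimage /= !in_itv/= !andbT pmulr_lge0
  ?invr_gt0.
Qed.

(** * Choquet integrals of nonnegative functions for a monotone subadditive set function *)

Section layer_cake.
Context {R : realType} (S : set R) (nu : set R -> R).
Context (nu0 : nu set0 = 0).
Context (nu_mono : forall A B, B `<=` S -> A `<=` B -> nu A <= nu B).
Context (nuU : forall A B, A `<=` S -> B `<=` S ->
  nu (A `|` B) <= nu A + nu B).

Local Notation mu := (fun A => (nu A)%:E).
Implicit Types (A B : set R) (b c K : R) (f g h : R -> R).
Local Notation lev A b f := (A `&` [set w : R | (b <= f w)%R]).

Definition layer (A : set R) (f : R -> R) : \bar R :=
  (\int[lebesgue_measure]_(b in `[0%R, +oo[) (nu (lev A b f))%:E)%E.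

Lemma nu_ge0 A : A `<=` S -> 0 <= nu A.
Proof. by move=> AS; rewrite -nu0 nu_mono. Qed.

Lemma lev_sub A b f : A `<=` S -> lev A b f `<=` S.
Proof. by move=> AS x [/AS]. Qed.

Hint Resolve lev_sub : core.

(** The level sets shrink as [b] grows, so the integrand is nonincreasing in [b]. *)
Lemma measurable_lev A f (D : set R) : A `<=` S -> measurable D ->
  measurable_fun D (fun b => (nu (lev A b f))%:E).
Proof.
move=> AS mD; apply/measurable_EFinP.
apply: (@nonincreasing_measurable R D) => [|b c bc]; first exact: mD.
by apply: nu_mono; [exact: lev_sub|move=> x [Ax] /= /(le_trans bc)].
Qed.

Hint Resolve measurable_lev : core.

Lemma layer_ge0 A f : A `<=` S -> (0 <= layer A f)%E.
Proof.
move=> AS; apply: integral_ge0 => b _; rewrite lee_fin nu_ge0//.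
exact: lev_sub.
Qed.

(** At a level [b <= 0] the level set is all of [A], so the second integrand of the Choquet integral
    vanishes. *)
Lemma choquet_layer A f : A `<=` S -> (forall x, A x -> 0 <= f x) ->
  choquet mu A f = layer A f.
Proof.
move=> AS f0; rewrite /choquet [X in (_ + X)%E]integral0_eq ?adde0// => b.
rewrite /= in_itv/= => b0; have -> : lev A b f = A; last by rewrite subee.
by apply/seteqP; split=> [x []//|x Ax]; split=> //=; exact: le_trans (f0 _ Ax).
Qed.

Lemma le_layer A B f g : B `<=` S ->
  (forall b, 0 <= b -> lev A b f `<=` lev B b g) ->
  A `<=` S -> (layer A f <= layer B g)%E.
Proof.
move=> BS AB AS; apply: ge0_le_integral => //; try exact: measurable_lev.
  by move=> b _; rewrite lee_fin nu_ge0//; exact: lev_sub.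
move=> b; rewrite /= in_itv/= andbT => /AB ABb.
by rewrite lee_fin; apply: nu_mono => //; exact: lev_sub.
Qed.

(** Subadditivity of [nu] is used level by level, and the Lebesgue integral over the levels is
    additive. The inclusion covers both a comparison with two functions and a splitting of the
    domain; each is used below. *)
Lemma layer_leU A B1 B2 f g h : A `<=` S -> B1 `<=` S -> B2 `<=` S ->
  (forall b, 0 <= b -> lev A b f `<=` lev B1 b g `|` lev B2 b h) ->
  (layer A f <= layer B1 g + layer B2 h)%E.
Proof.
move=> AS BS1 BS2 AB; rewrite /layer -ge0_integralD//; try exact: measurable_lev.
- apply: ge0_le_integral => //.
  + by move=> b _; rewrite lee_fin nu_ge0//; exact: lev_sub.
  + exact: measurable_lev.
  + by apply: emeasurable_funD; exact: measurable_lev.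
  + move=> b; rewrite /= in_itv/= andbT => /AB ABb.
    rewrite -EFinD lee_fin; apply: le_trans (nuU _ _); try exact: lev_sub.
    by apply: nu_mono => // x [] /lev_sub; exact.
- by move=> b _; rewrite lee_fin nu_ge0//; exact: lev_sub.
- by move=> b _; rewrite lee_fin nu_ge0//; exact: lev_sub.
Qed.

Lemma layer_scale A f c : A `<=` S -> 0 < c ->
  layer A (fun x => c * f x) = (c%:E * layer A f)%E.
Proof.
move=> AS c0; rewrite /layer -(@ge0_integral_scale _ _ (fun b => mu (lev A b f)))//.
- apply: eq_integral => b _; congr (nu _)%:E.
  by apply/seteqP; split=> x [Ax] /= h; split=> //=; move: h;
    rewrite ler_pdivrMr// mulrC.
- exact: measurable_lev.
- by move=> b; rewrite lee_fin nu_ge0//; exact: lev_sub.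
Qed.

Lemma layer_cst_le A K : A `<=` S -> 0 <= K ->
  (layer A (fun=> K) <= (K * nu A)%:E)%E.
Proof.
move=> AS K0.
have -> : (K * nu A)%:E =
    (\int[lebesgue_measure]_(b in `[0%R, K]) (cst (nu A)%:E b))%E.
  rewrite integral_cst; last exact: measurable_itv.
  rewrite /= lebesgue_measure_itv/= lte_fin EFinM muleC.
  by case: ltgtP K0 => // [_ _|<- _]; rewrite -?EFinB ?subr0// !mule0.
(* Equality holds: the level set is [A] for [0 <= b <= K] and empty above [K]. *)
rewrite le_eqVlt; apply/orP; left; apply/eqP.
rewrite /layer integral_mkcond [RHS]integral_mkcond; apply: eq_integral => b _.
rewrite !patchE !mem_setE !in_itv/= andbT.
have [b0/=|//] := leP 0 b; have [bK|Kb] := leP b K.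
  by congr (nu _)%:E; apply/seteqP; split=> [x []|].
congr (_%:E); rewrite -[RHS]nu0; congr nu.
by rewrite -subset0 => x [].
Qed.


(** The disjunction puts each level set of [f] inside the union of those of [c * g] and [d * h]. The
    last integral may run over a larger set [B], because later only integrals over the whole of
    [[0, 1]] are controlled there. *)
Lemma layer_le_max A B f g h c d : B `<=` S -> A `<=` B -> 0 < c -> 0 < d ->
  (forall x, A x -> f x <= c * g x \/ f x <= d * h x) ->
  (layer A f <= c%:E * layer A g + d%:E * layer B h)%E.
Proof.
move=> BS AB c0 d0 fgh; have AS := subset_trans AB BS.
rewrite -(layer_scale g AS c0) -(layer_scale h BS d0).
apply: layer_leU => // b _ x [Ax /= bf].
by case: (fgh x Ax) => h'; [left|right]; split => /=; [|exact: le_trans h'|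
  exact: AB|exact: le_trans h'].
Qed.

(** Where [f x > K], the factor [f x ^ (1 - p)] of [f x = f x ^ (1 - p) * f x ^ p] is at most
    [K ^ (1 - p)], since [1 - p < 0]. The height [K] stays free for later tuning. *)
Lemma layer_le_cst_powR A B f K p : B `<=` S -> A `<=` B -> 0 < K -> 1 < p ->
  (forall x, A x -> 0 <= f x) ->
  (layer A f <= (K * nu A)%:E +
     (K `^ (1 - p))%:E * layer B (fun x => (`|f x| `^ p)%R))%E.
Proof.
move=> BS AB K0 p1 f0; have AS := subset_trans AB BS.
have h1 : (K%:E * layer A (fun=> 1%R) <= (K * nu A)%:E)%E.
  by rewrite EFinM lee_pmul2l// -[nu A]mul1r layer_cst_le.
apply: (le_trans _ (leeD h1 (lexx _))).
apply: layer_le_max => // [|x Ax]; first exact: powR_gt0.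
have [fK|Kf] := leP (f x) K; [left|right]; rewrite ?mulr1//.
rewrite ger0_norm ?f0// -(@mulr_powRB1 _ (f x) p) ?f0// ?(lt_trans ltr01)//.
rewrite mulrCA -[leLHS]mulr1.
rewrite ler_wpM2l ?f0// -opprB powRN ler_pdivlMl ?powR_gt0// mulr1.
by rewrite ge0_ler_powR ?subr_ge0 ?nnegrE ?f0 ?ltW.
Qed.

(** Starting from [f <= g + |f - g|]: if [|f - g| <= eta * g] the first bound holds, otherwise
    [g < |f - g| / eta] and the second does. *)
Lemma layer_le_dist A B f g eta : B `<=` S -> A `<=` B -> 0 < eta ->
  (layer A f <= (1 + eta)%:E * layer A g +
     (1 + eta^-1)%:E * layer B (fun x => `|f x - g x|%R))%E.
Proof.
move=> BS AB eta0; have ei0 : 0 < eta^-1 by rewrite invr_gt0.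
apply: layer_le_max; rewrite ?addr_gt0// => x Ax.
have fgd : f x <= g x + `|f x - g x| by rewrite -lerBlDl ler_norm.
have [h|h] := leP `|f x - g x| (eta * g x); [left|right].
- by rewrite (le_trans fgd)// mulrDl mul1r lerD2l.
- by rewrite (le_trans fgd)// mulrDl mul1r addrC lerD2l ler_pdivlMl// ltW.
Qed.

(** [|f|] is at most twice the larger of [|g|] and [|f - g|]. *)
Lemma layer_powR_le A f g p : A `<=` S -> 0 < p ->
  (layer A (fun x => (`|f x| `^ p)%R) <=
     (2 `^ p)%:E * layer A (fun x => (`|g x| `^ p)%R) +
     (2 `^ p)%:E * layer A (fun x => (`|f x - g x| `^ p)%R))%E.
Proof.
move=> AS p0; apply: layer_le_max; rewrite ?powR_gt0// => x Ax.
have fgd : `|f x| <= `|g x| + `|f x - g x|.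
  by rewrite (le_trans _ (ler_normD _ _))// addrCA subrr addr0.
rewrite -!powRM//.
have [h|h] := leP `|f x - g x| `|g x|; [left|right]; apply: ge0_ler_powR;
  rewrite ?nnegrE ?mulr_ge0 ?(ltW p0)//;
  apply: le_trans fgd _; rewrite mulr_natl mulr2n ?lerD2l//.
by rewrite lerD2r ltW.
Qed.

End layer_cake.

(** * An Arzela-Ascoli theorem for nonnegative continuous functions on the unit interval *)

Section ascoli.
Context {R : realType}.
Implicit Types (f g : C_plus R) (x y : unit_interval R) (W : set (C_plus R)).

Lemma C_plus_closure_near W f (e : R) : closure W f -> 0 < e ->
  exists2 g, W g & forall x, `|f x - g x| < e.
Proof.
move=> Wf e0; have [g [Wg fg]] := Wf _ (nbhsx_ballx f e e0).
exists g => // x; move: fg; rewrite ballEmdist/=.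
exact: le_lt_trans (le_uniform_dist f g x).
Qed.

(** For each [x] the values [f x] lie in the compact segment [[0, B]], so the image of [F] under
    evaluation at [x] has a cluster point, which is a limit because [F] is an ultrafilter. *)
Lemma C_plus_ultra_limit (F : set_system (C_plus R)) W (B : R) :
  UltraFilter F -> F W -> (forall f x, W f -> f x <= B) ->
  exists h : unit_interval R -> R,
    forall x (e : R), 0 < e -> F [set f | `|h x - f x| < e].
Proof.
move=> FU FW WB.
suff /choice : forall x, exists l : R,
    forall e : R, 0 < e -> F [set f | `|l - f x| < e].
  by move=> [h hF]; exists h.
move=> x; pose G := (fun f : C_plus R => f x : R) @ F.
have GI : F [set f | f x \in `[0, B]].
  by apply: filterS FW => f Wf; rewrite /= in_itv/= C_ge0 WB.
have [l [_ lG]] := @segment_compact R 0 B G _ GI.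
exists l => e e0.
have [//|FN] := in_ultra_setVsetC [set f : C_plus R | `|l - f x| < e] FU.
have [r [/= Nr lr]] := lG (~` ball l e) (ball l e) FN (nbhsx_ballx l e e0).
by [].
Qed.

Lemma modulus_continuous (h : unit_interval R -> R) :
  (forall e : R, 0 < e -> exists2 d : R, 0 < d &
     forall x y, `|set_val x - set_val y| < d -> `|h x - h y| <= e) ->
  continuous h.
Proof.
move=> hmod x; have Fx : Filter (nbhs x) by exact: nbhs_filter.
apply/(cvgrPdist_le (FF := Fx)) => e /hmod[d d0 hd].
have : \forall y \near x, `|set_val x - set_val y| < d.
  have sx : {for x, continuous (set_val : unit_interval R -> R)}.
    exact: initial_continuous.
  by move/cvgrPdist_lt : sx => /(_ d d0).
by apply: (@filterS _ _ Fx) => y; exact: hd.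
Qed.

(** An ultrafilter on the closure converges pointwise; the limit inherits nonnegativity and the
    modulus of continuity, and a finite grid upgrades the convergence to a uniform one. *)
Lemma C_plus_ascoli W (B : R) : (forall f x, W f -> f x <= B) ->
  (forall e : R, 0 < e -> exists2 d : R, 0 < d & forall f x y, W f ->
     `|set_val x - set_val y| < d -> `|f x - f y| <= e) ->
  compact (closure W).
Proof.
move=> WB Wmod; rewrite compact_ultra => F FU FW.
have FF : Filter F by have [[]] := FU.
(* The bound and the modulus are first carried over from [W] to its closure. *)
have {}WB f x : closure W f -> f x <= B.
  move=> Wf; apply/ler_addgt0Pr => e e0.
  have [g Wg fg] := C_plus_closure_near Wf e0.
  rewrite -lerBlDl (le_trans _ (ltW (fg x)))//.
  by rewrite (le_trans _ (ler_norm _))// lerB// WB.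
have {}Wmod (e : R) : 0 < e -> exists2 d : R, 0 < d &
    forall f x y, closure W f -> `|set_val x - set_val y| < d ->
      `|f x - f y| <= e.
  move=> e0; have e30 : 0 < e / 3 by rewrite divr_gt0.
  have [d d0 Wd] := Wmod _ e30; exists d => // f x y Wf xy.
  have [g Wg fg] := C_plus_closure_near Wf e30.
  have -> : f x - f y = (f x - g x) + (g x - g y) - (f y - g y) by ring.
  have := Wd g x y Wg xy; have := fg x; have := fg y.
  rewrite !ltr_norml !ler_norml => /andP[? ?] /andP[? ?] /andP[? ?].
  by apply/andP; split; lra.
have [h hF] := C_plus_ultra_limit FU FW WB.
have h0 x : 0 <= h x.
  apply/ler_addgt0Pr => e e0; have [f /=] := filter_ex (hF x e e0).
  by rewrite ltr_norml => /andP[+ _]; have := C_ge0 f x; lra.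
have hmod (e : R) : 0 < e -> exists2 d : R, 0 < d &
    forall x y, `|set_val x - set_val y| < d -> `|h x - h y| <= e.
  move=> e0; have e30 : 0 < e / 3 by rewrite divr_gt0.
  have [d d0 Wd] := Wmod _ e30; exists d => // x y xy.
  have [f [[fx fy] Wf]] :=
    filter_ex (filterI (filterI (hF x _ e30) (hF y _ e30)) FW).
  have := Wd f x y Wf xy; move: fx fy => /=.
  rewrite !ltr_norml !ler_norml => /andP[? ?] /andP[? ?] /andP[? ?].
  by apply/andP; split; lra.
have hc := modulus_continuous hmod.
pose hcts : continuousType (unit_interval R) R :=
  HB.pack h (isContinuous.Build _ _ h hc).
pose H := @CPlus R hcts h0.
have FH : F --> H.
  move=> U /nbhs_ballP[e /= e0 eU]; have e40 : 0 < e / 4 by rewrite divr_gt0.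
  have [d1 d10 Wd] := Wmod _ e40; have [d2 d20 hd] := hmod _ e40.
  pose d := Num.min d1 d2; have d0 : 0 < d by rewrite lt_min d10.
  pose n := Num.truncn d^-1; have n0 : 0 < n.+1%:R :> R by [].
  have nd : n.+1%:R^-1 < d by rewrite invf_plt ?posrE// truncnS_gt.
  (* There are [n.+2] grid points, both endpoints included: rounding [x = 1] down gives the index
     [n.+1]. *)
  have gridI (i : 'I_n.+2) : i%:R / n.+1%:R \in (`[0%R, 1%R]%classic : set R).
    rewrite inE/= in_itv/= divr_ge0//= ler_pdivrMr// mul1r ler_nat.
    by rewrite -ltnS.
  pose grid i : unit_interval R := SigSub (gridI i).
  have grid_near x : exists i, `|set_val x - set_val (grid i)| < d.
    have : set_val x \in `[0, 1] by have := set_valP x.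
    rewrite in_itv/= => /andP[x0 x1].
    have /truncn_itv/andP[ix xi] : 0 <= set_val x * n.+1%:R by rewrite mulr_ge0.
    have iN : (Num.truncn (set_val x * n.+1%:R) < n.+2)%N.
      by rewrite ltnS -(ler_nat R) (le_trans ix)// ler_piMl.
    exists (Ordinal iN); apply: le_lt_trans nd.
    rewrite (_ : set_val (grid _) =
      (Num.truncn (set_val x * n.+1%:R))%:R / n.+1%:R)// ger0_norm.
      by rewrite lerBlDl -[X in _ + X]mul1r -mulrDl natr1 ler_pdivlMr// ltW.
    by rewrite subr_ge0 ler_pdivrMr.
  (* A finite intersection: [F] contains the set of functions close to [h] at all grid points at
     once. *)
  have FG := filter_forall FF (fun i => hF (grid i) _ e40).
  suff : F U by []; apply: filterS (filterI FW FG) => f [Wf hfg]; apply: eU.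
  rewrite ballEmdist/=.
  (* A supremum only yields a weak inequality; three quarters of [e] leave room for the strict
     one. *)
  suff : uniform_dist H f <= e / 4 + e / 4 + e / 4.
    by move/le_lt_trans; apply; lra.
  apply: uniform_dist_le => x; have [i xi] := grid_near x.
  have hxi : `|h x - h (grid i)| <= e / 4.
    by apply: hd; apply: lt_le_trans xi _; rewrite ge_min lexx orbT.
  have fxi : `|f x - f (grid i)| <= e / 4.
    by apply: Wd => //; apply: lt_le_trans xi _; rewrite ge_min lexx.
  have := hfg i; move: hxi fxi => /=.
  rewrite !ltr_norml !ler_norml => /andP[? ?] /andP[? ?] /andP[? ?].
  by apply/andP; split; lra.
exists H; split=> //; apply: closed_closure => U UH.
by have [f] := filter_ex (filterI FW (FH _ UH)); exists f.
Qed.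
End ascoli.

(** * Monotonicity and subadditivity of the distorted Lebesgue measure *)

Lemma le_lebesgue_measure (R : realType) (A B : set R) :
  A `<=` B -> (lebesgue_measure A <= lebesgue_measure B)%E.
Proof. exact: (@le_outer_measure _ _ ((@wlength R idfun)^*)%mu). Qed.

(** On arbitrary sets [lebesgue_measure] is the Lebesgue outer measure, hence still monotone and
    subadditive. *)
Lemma lebesgue_measureU_le (R : realType) (A B : set R) :
  (lebesgue_measure (A `|` B) <= lebesgue_measure A + lebesgue_measure B)%E.
Proof. exact: (@outer_measureU2 _ _ ((@wlength R idfun)^*)%mu). Qed.

(** Concavity between [0] and [s + t] puts [gamma r] above the chord [r / (s + t) * gamma (s + t)];
    the cases [r = s] and [r = t] are added. *)
Lemma concave_subadditive (R : realType) (gamma : R -> R) (s t : R) :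
  concave_on `[0, 1] gamma -> gamma 0 = 0 -> 0 <= s -> 0 <= t -> s + t <= 1 ->
  gamma (s + t) <= gamma s + gamma t.
Proof.
move=> gammaC gamma0 s0 t0 st1.
have [u0|u0] := eqVneq (s + t) 0.
  have [-> ->] : s = 0 /\ t = 0 by split; lra.
  by rewrite addr0 gamma0 addr0.
have {}u0 : 0 < s + t by rewrite lt0r u0 addr_ge0.
have key r : 0 <= r -> r <= s + t -> r / (s + t) * gamma (s + t) <= gamma r.
  move=> r0 ru; have := gammaC (s + t) 0 (r / (s + t)).
  rewrite gamma0 !mulr0 !addr0 divfK ?gt_eqF//; apply.
  - by rewrite /= in_itv/= ltW.
  - by rewrite /= in_itv/= lexx ler01.
  - by rewrite divr_ge0 ?(ltW u0)//= ler_pdivrMr// mul1r.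
apply: le_trans (lerD (key s s0 _) (key t t0 _)); rewrite ?lerDl ?lerDr//.
by rewrite -mulrDl -mulrDl divff ?gt_eqF// mul1r.
Qed.

Section distorted_measure.
Context {R : realType} (gamma : R -> R).
Context (gamma_nd : {in `[0, 1] &, {homo gamma : x y / x <= y}}).
Context (gammaC : concave_on `[0, 1] gamma).
Context (gamma_cont : {within `[0, 1], continuous gamma}).
Context (gamma0 : gamma 0 = 0).

Local Notation I := (`[0%R, 1%R]%classic : set R).

(** Real-valued twin of [distorted_lebesgue], in the form required of [nu] in the section on
    layers. *)
Definition distorted (A : set R) : R := gamma (fine (lebesgue_measure A)).

(** This keeps [fine] away from its default value and the argument of [gamma] inside [[0, 1]]. *)
Lemma lebesgue01 (A : set R) : A `<=` I ->
  (lebesgue_measure A)%E \is a fin_num /\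
  fine (lebesgue_measure A) \in `[0, 1].
Proof.
move=> /le_lebesgue_measure.
rewrite lebesgue_measure_itv/= lte01 sube0 => A1.
have A0 : (0 <= lebesgue_measure A)%E.
  have := @le_lebesgue_measure R set0 A (@sub0set _ A); rewrite measure0.
  exact.
have Af : (lebesgue_measure A)%E \is a fin_num.
  by rewrite ge0_fin_numE// (le_lt_trans A1)// ltry.
by split => //; rewrite in_itv/= fine_ge0//= -lee_fin fineK.
Qed.

Lemma distorted_set0 : distorted set0 = 0.
Proof. by rewrite /distorted measure0. Qed.

Lemma distorted_le (A B : set R) : B `<=` I -> A `<=` B ->
  distorted A <= distorted B.
Proof.
move=> BI AB; have [Af A01] := lebesgue01 (subset_trans AB BI).
have [Bf B01] := lebesgue01 BI.
by apply: gamma_nd => //; rewrite fine_le//; exact: le_lebesgue_measure.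
Qed.

Lemma distortedU_le (A B : set R) : A `<=` I -> B `<=` I ->
  distorted (A `|` B) <= distorted A + distorted B.
Proof.
move=> AI BI; have UI : A `|` B `<=` I by move=> x [/AI|/BI].
have [[Af A01] [Bf B01]] := (lebesgue01 AI, lebesgue01 BI).
have [Uf U01] := lebesgue01 UI; have := lebesgue_measureU_le A B.
rewrite -(fineK Af) -(fineK Bf) -(fineK Uf) -EFinD lee_fin /distorted.
move: (fine (lebesgue_measure A)) (fine (lebesgue_measure B))
  (fine (lebesgue_measure (A `|` B))) A01 B01 U01 => a b u A01 B01 U01 uab.
move: (A01) (B01) (U01).
rewrite !in_itv/= => /andP[a0 a1] /andP[b0 b1] /andP[u0 u1].
(* The sum [a + b] may exceed [1], where nothing is known of [gamma]. So [u] is split as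
   [a + (u - a)], with [u - a <= b]. *)
have [ua|au] := leP u a.
  apply: le_trans (gamma_nd U01 A01 ua) _; rewrite lerDl -gamma0.
  by apply: gamma_nd; rewrite // in_itv/= lexx ler01.
rewrite -(subrKC a u).
apply: le_trans (concave_subadditive gammaC gamma0 a0 _ _) _; try lra.
by rewrite lerD2l gamma_nd// ?in_itv/=; lra.
Qed.

Lemma distorted_itv (x y : R) : x <= y -> distorted `[x, y] = gamma (y - x).
Proof.
move=> xy; rewrite /distorted lebesgue_measure_itv/= lte_fin.
by case: ltgtP xy => // -> _; rewrite subrr.
Qed.

Lemma gamma_small (e : R) : 0 < e ->
  exists2 d : R, 0 < d & forall t, 0 <= t < d -> t <= 1 -> gamma t <= e.
Proof.
move=> e0; have [_ g0 _] := (continuous_within_itvP gamma ltr01).1 gamma_cont.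
have /cvgrPdist_le/(_ e e0) := g0.
rewrite gamma0 => -[d /= d0 dP]; exists d => // t /andP[t0 td] t1.
(* The right limit at [0] says nothing about [t = 0] itself. *)
have [->|tN0] := eqVneq t 0; first by rewrite gamma0 ltW.
have := dP t; rewrite /ball_/= !sub0r !normrN ger0_norm// => /(_ td).
by rewrite lt0r tN0 t0 => /(_ isT); apply: le_trans; exact: ler_norm.
Qed.

End distorted_measure.

Lemma powR_onto (R : realType) (r s : R) : 0 < r -> s != 0 ->
  exists2 K : R, 0 < K & K `^ s = r.
Proof.
move=> r0 s0; exists (r `^ s^-1); first exact: powR_gt0.
by rewrite -powRrM mulVf// powRr1// ltW.
Qed.

(** * Estimates for the Volterra-Choquet operator *)

Section volterra.
Context {R : realType} (C : set (set R)) (gamma : R -> R).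
Context (gamma_nd : {in `[0, 1] &, {homo gamma : x y / x <= y}}).
Context (gammaC : concave_on `[0, 1] gamma).
Context (gamma_cont : {within `[0, 1], continuous gamma}).
Context (gamma0 : gamma 0 = 0).
Context (p : R) (p_gt1 : 1 < p).

Local Notation I := (`[0%R, 1%R]%classic : set R).
Local Notation nu := (distorted gamma).
Local Notation mu := (distorted_lebesgue gamma).
Local Notation lay := (layer nu).
Local Notation Lp := (Lp_plus C mu p).
Implicit Types f g : Lp.

Let nu0 : nu set0 = 0 := distorted_set0 gamma0.
Let nu_mono : forall A B, B `<=` I -> A `<=` B -> nu A <= nu B :=
  distorted_le gamma_nd.
Let nuU : forall A B, A `<=` I -> B `<=` I -> nu (A `|` B) <= nu A + nu B :=
  distortedU_le gamma_nd gammaC gamma0.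

Let p_gt0 : 0 < p. Proof. exact: lt_trans p_gt1. Qed.

Lemma nuI_ge0 : 0 <= nu I.
Proof. exact: (nu_ge0 nu0 nu_mono). Qed.

(** The [p]-th power of the norm of [h]; roots then appear only in the link with [Lp_dist]. *)
Definition powint (h : R -> R) : \bar R := lay I (fun t => (`|h t| `^ p)%R).

Lemma eq_powint h k : (forall t, `|h t| = `|k t|) -> powint h = powint k.
Proof. by move=> hk; congr layer; apply/funext => t; rewrite hk. Qed.

Lemma powint_ge0 h : (0 <= powint h)%E.
Proof. exact: (layer_ge0 nu0 nu_mono). Qed.

Lemma choquet_powint h : choquet mu I (fun t => (`|h t| `^ p)%R) = powint h.
Proof. by apply: (choquet_layer (S := I)) => // x _; exact: powR_ge0. Qed.

Lemma powint_lty f : (powint f < +oo)%E.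
Proof. by rewrite -choquet_powint; exact: Lp_finite. Qed.

Lemma powint_fineK f : (fine (powint f))%:E = powint f.
Proof. by rewrite fineK// ge0_fin_numE ?powint_lty// powint_ge0. Qed.

Lemma Lp_distE f g : Lp_dist f g = (powint (f \- g)%R `^ p^-1)%E.
Proof. by rewrite /Lp_dist /choquet_Lp_norm choquet_powint. Qed.

Lemma powint_dist f g : powint (f \- g) = (Lp_dist f g `^ p)%E.
Proof.
by rewrite Lp_distE -poweRrM mulVf ?gt_eqF// poweRe1// powint_ge0.
Qed.

(** A substitute for the triangle inequality of the norm: it bounds [powint f] for [f] at controlled
    distance from [g]. *)
Lemma powint_le f g (M D : R) :
  (powint g <= M%:E)%E -> (powint (g \- f)%R <= D%:E)%E ->
  (powint f <= (2 `^ p * (M + D))%:E)%E.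
Proof.
rewrite (@eq_powint (g \- f)%R (f \- g)%R); last by move=> t; rewrite distrC.
move=> gM fgD; rewrite mulrDr EFinD !EFinM.
apply: (le_trans (layer_powR_le nu0 nu_mono nuU f g (@subset_refl _ I) p_gt0)).
have p20 : (0 <= (2 `^ p)%:E :> \bar R)%E by rewrite lee_fin powR_ge0.
exact: leeD (lee_wpmul2l p20 gM) (lee_wpmul2l p20 fgD).
Qed.

Lemma prefix_sub (x : R) : x <= 1 -> `[0, x]%classic `<=` I.
Proof.
by move=> x1 t; rewrite /= !in_itv/= => /andP[-> /le_trans]; apply.
Qed.

Definition volterra (h : R -> R) (x : R) : R := fine (lay `[0, x] h).

Lemma layer_le_powint (A : set R) (h : R -> R) K M : A `<=` I -> 0 < K ->
  (forall x, A x -> 0 <= h x) -> (powint h <= M%:E)%E ->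
  (lay A h <= (K * nu A + K `^ (1 - p) * M)%:E)%E.
Proof.
move=> AI K0 h0 hM; apply: (le_trans
  (layer_le_cst_powR nu0 nu_mono nuU (@subset_refl _ I) AI K0 p_gt1 h0)).
by rewrite EFinD leeD// [leRHS]EFinM lee_wpmul2l// lee_fin powR_ge0.
Qed.

Lemma layer_fin (A : set R) f : A `<=` I -> lay A f \is a fin_num.
Proof.
move=> AI; rewrite ge0_fin_numE ?(layer_ge0 nu0 nu_mono)//.
have := @layer_le_powint A f 1 (fine (powint f)) AI ltr01.
rewrite powint_fineK => /(_ _ (lexx _)) h.
by apply: (le_lt_trans (h _)); rewrite ?ltry// => x /AI; exact: Lp_ge0.
Qed.

Lemma volterraE f (x : R) : x <= 1 -> (volterra f x)%:E = lay `[0, x] f.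
Proof. by move=> x1; rewrite fineK// layer_fin//; exact: prefix_sub. Qed.

Lemma volterra_choquetE f (x : R) : x <= 1 ->
  (volterra f x)%:E = volterra_choquet mu f x.
Proof.
move=> x1; rewrite volterraE// /volterra_choquet.
have xI := prefix_sub x1; apply/esym/(choquet_layer (S := I)) => // t /xI.
exact: Lp_ge0.
Qed.

Lemma volterra_ge0 f (x : R) : x <= 1 -> 0 <= volterra f x.
Proof.
move=> x1; rewrite -lee_fin volterraE// (layer_ge0 nu0 nu_mono)//.
exact: prefix_sub.
Qed.

Lemma volterra_le f (x M : R) : x <= 1 -> (powint f <= M%:E)%E ->
  volterra f x <= nu I + M.
Proof.
move=> x1 fM; have xI := prefix_sub x1; rewrite -lee_fin volterraE//.
have f0 t : `[0, x]%classic t -> 0 <= f t by move/xI; exact: Lp_ge0.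
apply: (le_trans (layer_le_powint xI ltr01 f0 fM)).
by rewrite mul1r powR1 mul1r lee_fin lerD2r nu_mono.
Qed.

(** By monotonicity the difference is nonnegative; splitting [[0, y]] at [x], subadditivity bounds
    it by the integral over [[x, y]], a set of distorted measure [gamma (y - x)]. *)
Lemma volterra_modulus f (x y K M : R) : 0 <= x -> x <= y -> y <= 1 -> 0 < K ->
  (powint f <= M%:E)%E ->
  `|volterra f y - volterra f x| <= K * gamma (y - x) + K `^ (1 - p) * M.
Proof.
move=> x0 xy y1 K0 fM; have x1 := le_trans xy y1.
have [xI yI] := (prefix_sub x1, prefix_sub y1).
have xyI : `[x, y]%classic `<=` I.
  by move=> t; rewrite /= !in_itv/= => /andP[/(le_trans x0) -> /le_trans]; apply.
rewrite ger0_norm; last first.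
  rewrite subr_ge0 -lee_fin (volterraE f x1) (volterraE f y1).
  apply: (le_layer nu0 nu_mono) => // b _ t [tx bf]; split => //.
  by move: tx; rewrite /= !in_itv/= => /andP[-> /le_trans]; apply.
rewrite lerBlDl -lee_fin EFinD (volterraE f x1) (volterraE f y1).
have f0 t : `[x, y]%classic t -> 0 <= f t by move/xyI; exact: Lp_ge0.
rewrite -(distorted_itv _ xy).
apply: (le_trans _ (leeD2l _ (layer_le_powint xyI K0 f0 fM))).
apply: (layer_leU nu0 nu_mono nuU) => // b _ t [ty bf].
have [tx|/ltW xt] := leP t x; [left|right]; split => //; move: ty;
  by rewrite /= !in_itv/= => /andP[t0 ty]; exact/andP.
Qed.

(** The integral of [|f - g|] is enlarged to [[0, 1]] and then bounded through its [p]-th power, so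
    the error term does not depend on [x]. *)
Lemma volterra_dist f g (x eta K D : R) : x <= 1 -> 0 < eta -> 0 < K ->
  (powint (f \- g)%R <= D%:E)%E ->
  volterra f x <= (1 + eta) * volterra g x +
    (1 + eta^-1) * (K * nu I + K `^ (1 - p) * D).
Proof.
move=> x1 eta0 K0 fgD; have xI := prefix_sub x1.
rewrite -lee_fin EFinD !EFinM (volterraE f x1) (volterraE g x1).
apply: (le_trans (layer_le_dist nu0 nu_mono nuU f g (@subset_refl _ I) xI eta0)).
rewrite leeD// lee_pmul2l//; last first.
  by rewrite lte_fin addr_gt0// invr_gt0.
suff hD : (powint (fun t => `|f t - g t|%R) <= D%:E)%E.
  by apply: (layer_le_powint (@subset_refl _ I) K0 _ hD) => t _; exact: normr_ge0.
by rewrite (@eq_powint _ (f \- g)%R) => // t; rewrite normr_id.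
Qed.

Lemma volterra_equicontinuous (M e : R) : 0 < e -> exists2 d : R, 0 < d &
  forall f (x y : R), (powint f <= M%:E)%E -> I x -> I y ->
    `|x - y| < d -> `|volterra f x - volterra f y| <= e.
Proof.
move=> e0; have e20 : 0 < e / 2 by rewrite divr_gt0.
(* [K] is chosen with [K ^ (1 - p)] equal to this number, so the term in [M] is at most [e / 2].
   Only then is [d] chosen, making [K * gamma (y - x)] at most [e / 2]. *)
have r0 : 0 < e / 2 / (`|M| + 1) by rewrite divr_gt0// ltr_wpDl.
have [|K K0 Kr] := @powR_onto R _ (1 - p) r0.
  by rewrite subr_eq0 lt_eqF.
have [d d0 gd] := gamma_small gamma_cont gamma0 (divr_gt0 e20 K0).
exists d => // f x y fM.
wlog xy : x y / x <= y.
  move=> wl Ix Iy xyd; have [xy|/ltW yx] := leP x y; first exact: wl.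
  by rewrite distrC; apply: wl => //; rewrite distrC.
rewrite /= !in_itv/= => /andP[x0 x1] /andP[y0 y1]; rewrite distrC.
rewrite ger0_norm ?subr_ge0// => yxd; rewrite distrC.
apply: (le_trans (volterra_modulus x0 xy y1 K0 fM)).
rewrite [leRHS]splitr lerD//.
  rewrite mulrC -ler_pdivlMr//; apply: gd; last by lra.
  by rewrite subr_ge0 xy.
rewrite Kr mulrAC ler_pdivrMr ?ltr_wpDl// ler_wpM2l// ?(ltW e20)//.
by rewrite (le_trans (ler_norm _))// lerDl.
Qed.

Lemma volterra_continuous f :
  continuous (fun x : unit_interval R => volterra f (set_val x)).
Proof.
apply: modulus_continuous => e e0.
have [d d0 fd] := volterra_equicontinuous (fine (powint f)) e0.
exists d => // x y; apply: fd; last 2 first.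
- exact: (set_valP x).
- exact: (set_valP y).
by rewrite powint_fineK.
Qed.

Lemma volterra_unit_ge0 f (x : unit_interval R) : 0 <= volterra f (set_val x).
Proof.
by apply: volterra_ge0; have := set_valP x; rewrite /= in_itv/= => /andP[].
Qed.

Definition volterra_op f : C_plus R :=
  let h := fun x : unit_interval R => volterra f (set_val x) in
  @CPlus R (HB.pack_for (continuousType (unit_interval R) R) h
    (isContinuous.Build _ _ h (@volterra_continuous f))) (volterra_unit_ge0 f).

(** The constants come in the order [B], [eta], [K], [D]: [B] bounds both values of the operator,
    then [eta] makes [eta * B] small, which fixes the factor [c]; [K] absorbs [c] in the term with
    [nu I], and [D] in the last one. Each term gets [e / 3]. *)
Lemma volterra_small f (e : R) : 0 < e -> exists2 D : R, 0 < D &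
  forall g, (powint (f \- g)%R < D%:E)%E ->
    forall x : R, I x -> `|volterra f x - volterra g x| <= e.
Proof.
move=> e0; pose M := fine (powint f).
have fM : powint f = M%:E by rewrite powint_fineK.
have M0 : 0 <= M by rewrite -lee_fin -fM powint_ge0.
have nuI0 := nuI_ge0.
have p20 : 0 < 2 `^ p :> R by exact: powR_gt0.
pose B := nu I + M + 2 `^ p * (M + 1).
have B0 : 0 <= B by rewrite !addr_ge0// mulr_ge0 ?addr_ge0// ltW.
pose eta := e / 3 / (B + 1).
have eta0 : 0 < eta by rewrite !divr_gt0// ltr_wpDl.
have etaB : eta * B <= e / 3.
  by rewrite mulrAC ler_pdivrMr ?ltr_wpDl// ler_wpM2l ?divr_ge0 ?(ltW e0)// lerDl.
pose c := 1 + eta^-1; have c0 : 0 < c by rewrite addr_gt0// invr_gt0.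
pose K := e / 3 / (c * (nu I + 1)).
have K0 : 0 < K by rewrite !divr_gt0// mulr_gt0// ltr_wpDl.
have cK : c * (K * nu I) <= e / 3.
  have n1 : 0 < nu I + 1 by rewrite ltr_wpDl.
  rewrite (_ : c * (K * nu I) = e / 3 * (nu I / (nu I + 1))).
    by rewrite ler_piMr ?divr_ge0 ?(ltW e0)// ler_pdivrMr// mul1r lerDl.
  by rewrite /K; field; rewrite !gt_eqF.
have Kp0 : 0 < K `^ (1 - p) by exact: powR_gt0.
pose D := e / 3 / (c * K `^ (1 - p)).
have D0 : 0 < D by rewrite !divr_gt0// mulr_gt0.
have cD : c * (K `^ (1 - p) * D) = e / 3.
  by rewrite mulrA mulrC divfK// mulf_neq0// gt_eqF.
(* The [1] bounds [powint g] in advance, so that [B] does not depend on [g]. *)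
exists (Num.min 1 D); first by rewrite lt_min ltr01.
move=> g; rewrite EFin_min lt_min => /andP[fg1 fgD] x Ix.
have x1 : x <= 1 by move: Ix; rewrite /= in_itv/= => /andP[].
have gfE : powint (g \- f)%R = powint (f \- g)%R.
  by apply: eq_powint => t; rewrite distrC.
have gM : (powint g <= (2 `^ p * (M + 1))%:E)%E.
  by apply: (@powint_le g f); [rewrite fM|exact: ltW].
have vf : volterra f x <= B.
  apply: le_trans (volterra_le x1 (_ : (_ <= M%:E)%E)) _; first by rewrite fM.
  by rewrite lerDl mulr_ge0 ?addr_ge0// ltW.
have vg : volterra g x <= B.
  by apply: le_trans (volterra_le x1 gM) _; rewrite /B -addrA lerD2l lerDr.
have fg := volterra_dist x1 eta0 K0 (ltW fgD).
have gf : (powint (g \- f)%R <= D%:E)%E by rewrite gfE ltW.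
have {}gf := volterra_dist x1 eta0 K0 gf.
rewrite -/c mulrDr cD in fg gf.
have ef := le_trans (ler_wpM2l (ltW eta0) vf) etaB.
have eg := le_trans (ler_wpM2l (ltW eta0) vg) etaB.
rewrite ler_norml; move: (volterra f x) (volterra g x) ef eg fg gf {vf vg} => u v.
by move=> ef eg fg gf; apply/andP; split; lra.
Qed.

End volterra.

(** * Continuity and compactness of the operator *)

Theorem corollary4p3 (R : realType) (C : set (set R))
  (hC : C = @borel_sets R \/ C = @lebesgue_sets R)
  (gamma : R -> R)
  (gamma_nondecreasing : {in `[0, 1] &, {homo gamma : x y / x <= y}})
  (gamma_concave : concave_on `[0, 1] gamma)
  (gamma_continuous : {within `[0, 1], continuous gamma})
  (gamma0 : gamma 0 = 0)
  (p : R) (p_gt1 : 1 < p) :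
  exists V : Lp_plus C (distorted_lebesgue gamma) p -> C_plus R,
    (forall f (x : unit_interval R),
       (V f x)%:E = volterra_choquet (distorted_lebesgue gamma) f (set_val x)) /\
    compact_operator (@Lp_dist R C (distorted_lebesgue gamma) p) V.
Proof.
have p_gt0 : 0 < p := lt_trans ltr01 p_gt1.
pose V := @volterra_op R C gamma gamma_nondecreasing gamma_concave
  gamma_continuous gamma0 p p_gt1.
have Vcont : rho_continuous (@Lp_dist R C (distorted_lebesgue gamma) p) V.
  move=> f e e0; have e20 : 0 < e / 2 by rewrite divr_gt0.
  have [D D0 fD] := volterra_small gamma_nondecreasing gamma_concave
    gamma0 p_gt1 f e20.
  (* The distance is the [p]-th root of [powint], so the threshold [D] becomes its [p]-th root. *)
  exists (D `^ p^-1); first exact: powR_gt0.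
  move=> g; rewrite Lp_distE// -poweR_EFin => fg.
  have {}fg : (powint gamma p (f \- g)%R < D%:E)%E.
    rewrite ltNge; apply/negP => h; move: fg; rewrite ltNge => /negP; apply.
    apply: gt0_ler_poweR => //; rewrite ?invr_ge0 ?ltW//.
      by rewrite in_itv/= lee_fin ltW//= leey.
    by rewrite in_itv/= powint_ge0//= leey.
  suff : uniform_dist (V f) (V g) <= e / 2 by move/le_lt_trans; apply; lra.
  by apply: uniform_dist_le => x; apply: fD => //; exact: (set_valP x).
exists V; split.
  move=> f x; rewrite -(volterra_choquetE gamma_nondecreasing)//.
  by have := set_valP x; rewrite /= in_itv/= => /andP[].
split => //.
  (* Being well defined on classes follows from continuity: a distance [0] is below every [d]. *)
  move=> f g fg0; apply/mdist_positivity/eqP; rewrite eq_le mdist_ge0 andbT.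
  apply/ler_addgt0Pr => e e0; rewrite add0r; have [d d0 fd] := Vcont f e e0.
  by rewrite ltW// fd// fg0 lte_fin.
(* A nonempty [M] supplies a centre [g]; all its elements lie within the diameter [s] of [g]. *)
move=> M Mb; have [->|/set0P[g Mg]] := eqVneq M set0.
  by rewrite image_set0 closure0; exact: compact0.
move: Mb; rewrite /rho_bounded; set s := ereal_sup _ => Mb.
have [N gN] : exists N : R, powint gamma p g = N%:E.
  by exists (fine (powint gamma p g)); rewrite powint_fineK.
have [D sD] : exists D : R, (s `^ p <= D%:E)%E.
  exists (fine (s `^ p)%E); rewrite fineK//.
  by rewrite ge0_fin_numE ?poweR_ge0// poweR_lty.
have MD f : M f -> (powint gamma p f <= (2 `^ p * (N + D))%:E)%E.
  move=> Mf; apply: (powint_le _ _ _ _ (g := g)) => //; first by rewrite gN.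
  rewrite powint_dist//; apply: le_trans sD; apply: gt0_ler_poweR.
  - exact: ltW.
  - by rewrite in_itv/= Lp_distE// poweR_ge0/= leey.
  - rewrite in_itv/= leey andbT.
    (* The distance from [g] to itself shows that the supremum [s] is nonnegative. *)
    have gs : (Lp_dist g g <= s)%E by apply: ereal_sup_ubound; exists (g, g).
    by apply: le_trans gs; rewrite Lp_distE// poweR_ge0.
  - by apply: ereal_sup_ubound; exists (g, f).
apply: (@C_plus_ascoli _ _ (distorted gamma `[0%R, 1%R] + 2 `^ p * (N + D))).
  move=> _ x [f Mf <-]; apply: volterra_le => //; last exact: MD.
  by have := set_valP x; rewrite /= in_itv/= => /andP[].
move=> e e0; have [d d0 Hd] := volterra_equicontinuous C gamma_nondecreasing
  gamma_concave gamma_continuous gamma0 p_gt1 (2 `^ p * (N + D)) e0.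
exists d => // _ x y [f Mf <-]; apply: Hd; [exact: MD|exact: (set_valP x)|].
exact: (set_valP y).
Qed.
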